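(* Let $K$ be a field, $L=\{x_1,\dots,x_n\}$ a finite distributive lattice, and $I_L\subset S=K[x_1,\dots,x_n]$ the toric ideal of the Hibi ring $\mathcal R_K[L]$ of $L$. Let $<_{\rm rev}$ be a reverse lexicographic order on $S$ with the property that $x_i<_{\rm rev}x_j$ whenever $x_i<x_j$ in $L$. The following conditions are equivalent: (i) $I_L$ is of König type with respect to $f_{i,j}$ and $<_{\rm rev}$, i.e. with $h=\operatorname{height}I_L$, there are $h$ binomials among the $f_{i,j}$ (with $x_i,x_j$ incomparable in $L$) whose initial monomials with respect to $<_{\rm rev}$ form a regular sequence. (ii) $L$ is thin. (iii) The incomparability graph $\operatorname{incom}(L)$ is bipartite.
   Context: By Birkhoff's theorem, a finite distributive lattice $L$ is the lattice $\mathcal J(P)$ of poset ideals (down-closed subsets, ordered by inclusion) of a unique finite poset $P=\{p_1,\dots,p_d\}$. The Hibi ring of $L=\mathcal J(P)$ is the toric ring $\mathcal R_K[L]=K[u_\alpha : \alpha\in\mathcal J(P)]\subset K[z_1,\dots,z_d,t]$, where $u_\alpha=t\prod_{p_i\in\alpha}z_i$. Its toric ideal $I_L$ is the kernel of the surjection $S=K[x_\alpha : \alpha\in L]\to\mathcal R_K[L]$, $x_\alpha\mapsto u_\alpha$; here the variables are identified with the elements of $L$, so $S=K[x_1,\dots,x_n]$. For $x_i,x_j$ incomparable in $L$, $f_{i,j}=x_ix_j-(x_i\wedge x_j)(x_i\vee x_j)$; these binomials generate $I_L$. An antichain is a set of pairwise incomparable elements; a finite poset is thin if it has no antichain with at least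 $3$ elements. The incomparability graph $\operatorname{incom}(L)$ is the graph on $[n]$ whose edges are the $\{i,j\}$ such that $x_i$ and $x_j$ are incomparable in $L$. *)

(* Defs.v *)
From HB Require Import structures.
From mathcomp Require Import all_boot all_order all_algebra.
From mathcomp Require Import all_fingroup ring_quotient.
From mathcomp Require Export mpoly.

Set Implicit Arguments.
Unset Strict Implicit.
Unset Printing Implicit Defensive.

Import Order.TTheory GRing.Theory.
Local Open Scope ring_scope.

Section CommutativeAlgebra.

(* A chain P_0 < P_1 < ... < P_k = P of prime ideals; [c] is only meaningful
   on indices [<= k]. *)
Definition prime_chain (R : comNzRingType) (P : prime_idealr R) (k : nat) :
    Prop :=
  exists c : nat -> prime_idealr R,
    c k =i P /\
    forall i, (i < k)%N -> {subset c i <= c i.+1} /\ ~ {subset c i.+1 <= c i}.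

Definition prime_height (R : comNzRingType) (P : prime_idealr R) (h : nat) :
    Prop :=
  prime_chain P h /\ forall k, prime_chain P k -> (k <= h)%N.

(* The height of an ideal is the minimum of the heights of the primes
   containing it; primes of infinite height satisfy [prime_height] for no
   natural number and so do not affect the minimum. *)
Definition ideal_height (R : comNzRingType) (I : {pred R}) (h : nat) : Prop :=
  (exists P : prime_idealr R, {subset I <= P} /\ prime_height P h) /\
  forall (P : prime_idealr R) (k : nat),
    {subset I <= P} -> prime_height P k -> (h <= k)%N.

Definition ideal_gen (R : comNzRingType) (s : seq R) (f : R) : Prop :=
  exists c : 'I_(size s) -> R, f = \sum_(i < size s) c i * s`_i.

Definition regular_sequence (R : comNzRingType) (s : seq R) : Prop :=
  (forall k f, (k < size s)%N ->
     ideal_gen (take k s) (f * s`_k) -> ideal_gen (take k s) f) /\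
  ~ ideal_gen s 1.

End CommutativeAlgebra.

Section MonomialOrders.

(* The (degree) reverse lexicographic order induced by
   x_(s 0) > x_(s 1) > ... > x_(s (n - 1)). *)
Definition revlex n (s : {perm 'I_n}) : rel 'X_{1..n} := fun u v =>
  (mdeg u < mdeg v)%N ||
  (mdeg u == mdeg v) &&
  [exists k : 'I_n, (v (s k) < u (s k))%N &&
    [forall l : 'I_n, (k < l)%N ==> (u (s l) == v (s l))]].

Definition revlex_order n (lt : rel 'X_{1..n}) : Prop :=
  exists s : {perm 'I_n}, lt =2 revlex s.

(* The [lt]-largest monomial of [f], and the monomial 1 when [f = 0]. *)
Definition initial_monomial (K : fieldType) n (lt : rel 'X_{1..n})
    (f : {mpoly K[n]}) : 'X_{1..n} :=
  head 0%MM
    [seq m <- msupp f | all (fun m' => (m' == m) || lt m' m) (msupp f)].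

Definition konig_type (K : fieldType) n (I : {pred {mpoly K[n]}})
    (gens : {mpoly K[n]} -> Prop) (lt : rel 'X_{1..n}) : Prop :=
  exists (h : nat) (fs : seq {mpoly K[n]}),
    [/\ ideal_height I h, size fs = h, uniq fs,
        (forall g, g \in fs -> gens g) &
        regular_sequence
          [seq ('X_[initial_monomial lt g] : {mpoly K[n]}) | g <- fs]].

End MonomialOrders.

Section Posets.

Local Open Scope order_scope.

Definition antichain d (T : finPOrderType d) (A : {set T}) : Prop :=
  {in A &, forall x y, x != y -> x >< y}.

Definition thin d (T : finPOrderType d) : Prop :=
  forall A : {set T}, antichain A -> ~ (3 <= #|A|)%N.

Definition poset_ideal d (P : finPOrderType d) (A : {set P}) : Prop :=
  forall p q, q <= p -> p \in A -> q \in A.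

(* [phi] identifies [L] with the lattice of poset ideals of [P], ordered by
   inclusion. *)
Definition ideal_lattice_iso d d' (L : finTBDistrLatticeType d)
    (P : finPOrderType d') (phi : L -> {set P}) : Prop :=
  [/\ {mono phi : a b / a <= b >-> a \subset b},
      forall a, poset_ideal (phi a) &
      forall A, poset_ideal A -> exists a, phi a = A].

End Posets.

Definition bipartite (V : finType) (e : rel V) : Prop :=
  exists A : {set V}, forall u v, e u v -> (u \in A) != (v \in A).

Section Hibi.

Variables (d : Order.disp_t) (L : finTBDistrLatticeType d).

(* L = {x_1, ..., x_n} with n = #|L|; [lelt] and [enum_rank] are mutually
   inverse. *)
Definition lelt (i : 'I_#|L|) : L := enum_val i.

Definition incom : rel 'I_#|L| := fun i j => (lelt i >< lelt j)%O.

Variables (K : fieldType).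

Definition hibi_binomial (i j : 'I_#|L|) : {mpoly K[#|L|]} :=
  'X_i * 'X_j - 'X_(enum_rank (lelt i `&` lelt j)%O) *
                'X_(enum_rank (lelt i `|` lelt j)%O).

Variables (d' : Order.disp_t) (P : finPOrderType d') (phi : L -> {set P}).

(* K[z_1, ..., z_d, t] has #|P| + 1 variables, the last one being t. *)
Definition hibi_monomial (A : {set P}) : {mpoly K[#|P|.+1]} :=
  'X_ord_max * \prod_(p in A) 'X_(widen_ord (leqnSn #|P|) (enum_rank p)).

Definition hibi_map (f : {mpoly K[#|L|]}) : {mpoly K[#|P|.+1]} :=
  comp_mpoly [tuple hibi_monomial (phi (lelt i)) | i < #|L|] f.

Definition hibi_ideal : {pred {mpoly K[#|L|]}} := [pred f | hibi_map f == 0].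

End Hibi.

Arguments incom {d} L i j.
Arguments hibi_binomial {d} L K i j.
Arguments hibi_ideal {d L} K {d' P} phi _.

(* Birkhoff's theorem: the hypothesis [ideal_lattice_iso] can always be met,
   with [P] the poset of join-irreducible elements of [L]. *)
Section Birkhoff.

Local Open Scope order_scope.
Variables (d : Order.disp_t) (L : finTBDistrLatticeType d).

Definition join_irr (p : L) : bool :=
  (p != \bot) && [forall a, forall b, (p == a `|` b) ==> (p == a) || (p == b)].

Definition join_irr_poset := {p : L | join_irr p}.

HB.instance Definition _ := SubFinite.on join_irr_poset.
HB.instance Definition _ :=
  [SubChoice_isSubPOrder of join_irr_poset by <: with d].

Lemma join_irr_separates (a b : L) :
  ~~ (a <= b) -> exists p, [/\ join_irr p, p <= a & ~~ (p <= b)].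
Proof.
move=> nab; pose P (c : L) := (c <= a) && ~~ (c <= b).
have Pa : P a by rewrite /P lexx.
case: (arg_minnP (fun c : L => #|[set x | x <= c]|) Pa) => c /andP[ca ncb] cmin.
exists c; split=> //; apply/andP; split.
  by apply: contraNneq ncb => ->; rewrite le0x.
apply/forallP => e; apply/forallP => f; apply/implyP => /eqP cef.
have below g : g <= c -> c != g -> g <= b.
  move=> gc ncg; apply: contraT => ngb.
  have /cmin : P g by rewrite /P (le_trans gc ca).
  rewrite leqNgt => /negP[]; apply/proper_card/properP; split.
    by apply/subsetP => x; rewrite !inE => /le_trans; apply.
  exists c; rewrite !inE ?lexx //.
  by apply: contra ncg => cg; rewrite eq_le cg gc.
apply: contraNT ncb; rewrite negb_or => /andP[nce ncf].
by rewrite cef leUx !below // cef ?leUl ?leUr.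
Qed.

Lemma join_irr_prime (p a b : L) :
  join_irr p -> p <= a `|` b -> (p <= a) || (p <= b).
Proof.
case/andP=> _ /forallP/(_ (p `&` a))/forallP/(_ (p `&` b))/implyP h pab.
have /h : p == (p `&` a) `|` (p `&` b) by rewrite -meetUr (meet_l pab).
by rewrite ![p == _]eq_sym -!leEmeet.
Qed.

Theorem birkhoff :
  exists (P : finPOrderType d) (phi : L -> {set P}), ideal_lattice_iso phi.
Proof.
exists join_irr_poset, (fun a => [set p | val p <= a]); split.
- move=> a b; apply/idP/idP => [/subsetP sab|ab]; last first.
    by apply/subsetP => p; rewrite !inE => /le_trans; apply.
  apply: contraT => /join_irr_separates[p [jp pa]].
  by have := sab (Sub p jp); rewrite !inE /= => ->.
- by move=> a p q qp; rewrite !inE; apply: le_trans.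
- move=> A idA; exists (\join_(q in A) val q); apply/setP => p; rewrite inE.
  apply/idP/idP => [|pA]; last exact: (joins_sup _ pA).
  have jp := valP p; rewrite -big_enum.
  have : {subset enum A <= A} by move=> q; rewrite mem_enum.
  elim: (enum A) => [|q s IHs] sA.
    by rewrite big_nil lex0; case/andP: jp => /negPf->.
  rewrite big_cons => /(join_irr_prime jp)/orP[pq|].
    by apply: idA (sA q (mem_head _ _)).
  by apply: IHs => r rs; apply: sA; rewrite inE rs orbT.
Qed.

End Birkhoff.

(* Main.v *)
From HB Require Import structures.
Require Import Defs.
From mathcomp Require Import all_boot all_order all_algebra.
From mathcomp Require Import all_fingroup ring_quotient.

(** Write n for the number of elements of L and d for that of P.  Every maximal
    chain of L has d + 1 elements, one of each rank |phi a|.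

    The height of the toric ideal is h = n - (d + 1) [hibi_height].  Elements
    algebraically independent modulo a prime remain so modulo a smaller prime
    Q0, and any f outside Q0 but inside the larger prime can be added to them
    [alg_indep_mod_snoc].  The variables along a maximal chain are independent
    modulo the toric ideal [flag_alg_indep], so a chain of k primes below it
    would give d + 1 + k independent elements in n variables; counting monomials
    shows that at most n are possible [alg_dependent].  Conversely every u_a is
    a ratio of products of the u_c with c in a fixed maximal chain, and freeing
    the remaining n - (d + 1) variables one at a time gives a strict chain of
    toric primes [toric_chain].

    The meet of incomparable i, j is the smallest variable of f_(i,j), so the
    reverse lexicographic order picks the initial monomial x_i x_j
    [initial_hibi_binomial], and squarefree quadratic monomials form a regular
    sequence exactly when their supports are disjoint [regular_quads].  Thus
    the Koenig property says that the incomparability graph has a matching of h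
    edges.

    Such a matching is tight: a maximal chain C misses only h elements and each
    edge has an end outside C, so exactly one.  Given an antichain a, b, c, the
    partners of these three elements are therefore comparable to one another
    and to the two other members of the antichain, which is contradictory
    [matching_thin].  If L is thin, each rank contains at most two elements and
    L is covered by two maximal chains [thin_two_flags]; they two-colour the
    incomparability graph, and the ranks with two elements are the h edges of a
    matching [thin_matching].  A bipartite graph has no triangle, so bipartite
    implies thin. *)

Set Implicit Arguments.
Unset Strict Implicit.
Unset Printing Implicit Defensive.

Import Order.TTheory GRing.Theory.
Local Open Scope ring_scope.

(** * Algebraic independence modulo a prime ideal *)

Section Indep.
Variable K : fieldType.

(** [msize] is one more than the degree; in this shape the bounds add up also
    when a factor vanishes. *)
Lemma msizeM_leS n (p q : {mpoly K[n]}) a b :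
  (msize p <= a.+1)%N -> (msize q <= b.+1)%N -> (msize (p * q) <= (a + b).+1)%N.
Proof.
move=> pa qb; rewrite msizeE big_seq; elim/big_ind: _ => // [x y|m].
  by rewrite geq_max => -> ->.
case/msuppM_le/allpairsP => -[m1 m2] /= [/msize_mdeg_lt m1p /msize_mdeg_lt m2q ->].
rewrite mdegD ltnS leq_add // -ltnS; first exact: leq_trans m1p pa.
exact: leq_trans m2q qb.
Qed.

Lemma msize_monomial_le n N (g : 'I_N -> {mpoly K[n]}) (a : 'I_N -> nat) e :
  (forall i, msize (g i) <= e.+1)%N ->
  (msize (\prod_i g i ^+ a i) <= (\sum_i a i * e).+1)%N.
Proof.
move=> ge; elim/big_ind2: _ => [|p x q y|i _]; first by rewrite msize1.
  exact: msizeM_leS.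
elim: (a i) => [|k IHk]; first by rewrite expr0 msize1.
by rewrite exprS mulSn msizeM_leS.
Qed.

(** Dimension count: the D^N monomials in the [g i] with exponents below D lie
    in a space of polynomials of dimension (D B)^n, and D^(n+1) > (D B)^n as soon
    as D > B^n. *)
Lemma alg_dependent n N (g : 'I_N -> {mpoly K[n]}) : (n < N)%N ->
  exists2 p : {mpoly K[N]}, p != 0 & mmap (@mpolyC n K) g p = 0.
Proof.
move=> ltnN; pose e := \max_i msize (g i); pose B := (N * e).+1.
pose D := (B ^ n).+1; pose E := (D * B)%N.
pose box a b := {ffun 'I_a -> 'I_b}.
pose mon a b (i : 'I_#|{: box a b}|) := [multinom (enum_val i k : nat) | k < a].
have mon_inj a b : injective (@mon a b).
  move=> i j /mnmP eqij; apply: enum_val_inj; apply/ffunP => k; apply: val_inj.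
  by have := eqij k; rewrite !mnmE.
(* Row i holds the coefficients of the i-th monomial in the [g k]; the box of
   side E contains all exponents that occur. *)
pose M := \matrix_(i < #|{: box N D}|, j < #|{: box n E}|)
            (\prod_k g k ^+ mon _ _ i k)@_(mon _ _ j).
have : kermx M != 0.
  rewrite kermx_eq0 /row_free neq_ltn (leq_ltn_trans (rank_leq_col _)) //.
  rewrite !card_ffun !card_ord expnMn (@leq_trans (D ^ n.+1)) //.
    by rewrite expnS mulnC ltn_pmul2r ?expn_gt0.
  by rewrite leq_pexp2l.
case/rowV0Pn => v /sub_kermxP vM v0.
exists (\sum_i v 0 i *: 'X_[mon _ _ i]).
  apply: contraNneq v0 => p0; apply/eqP/rowP => i; rewrite mxE.
  have := congr1 (mcoeff (mon _ _ i)) p0; rewrite mcoeff0 linear_sum /= (bigD1 i) //=.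
  rewrite mcoeffZ mcoeffX eqxx mulr1 big1 ?addr0 // => j /negPf ji.
  by rewrite mcoeffZ mcoeffX (inj_eq (@mon_inj _ _)) ji mulr0.
have -> : mmap (@mpolyC n K) g (\sum_i v 0 i *: 'X_[mon _ _ i]) =
          \sum_i v 0 i *: \prod_k g k ^+ mon _ _ i k.
  by rewrite raddf_sum; apply: eq_bigr => i _ /=; rewrite mmapZ mmapX mul_mpolyC.
apply/mpolyP => m; rewrite mcoeff0 linear_sum /=.
have [mE|/forallPn[k]] := boolP [forall k, m k < E]%N.
  have [j ->] : exists j, m = mon n E j.
    exists (enum_rank ([ffun k => Ordinal (forallP mE k)] : box n E)).
    by apply/mnmP => k; rewrite mnmE enum_rankK ffunE.
  have := congr1 (fun w : 'rV_ _ => w 0 j) vM; rewrite !mxE => vMj.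
  by rewrite -[RHS]vMj; apply: eq_bigr => i _; rewrite mcoeffZ mxE.
rewrite -leqNgt => Em; apply: big1 => i _; rewrite mcoeffZ.
rewrite (memN_msupp_eq0 (msize_mdeg_ge _)) ?mulr0 //.
apply: (@leq_trans (m k)); last by rewrite mdegE (bigD1 k) //= leq_addr.
apply: leq_trans (leq_trans (msize_monomial_le (e := e) _ _) _) Em.
  by move=> l; apply: leqW; apply: (leq_bigmax l).
have le_sum : (\sum_l mon N D i l * e <= N * (D * e))%N.
  rewrite -[X in (X * _)%N](card_ord N) -sum_nat_const leq_sum // => l _.
  by rewrite leq_mul2r mnmE ltnW ?orbT.
by rewrite (leq_ltn_trans le_sum) // /E /B mulnCA mulnS -addn1 addnC leq_add2r.
Qed.

End Indep.

Section Step.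
Variables (K : fieldType) (n : nat).
Implicit Types (Q : prime_idealr {mpoly K[n]}).

Definition alg_indep_mod N (Q : {pred {mpoly K[n]}})
    (g : 'I_N -> {mpoly K[n]}) : Prop :=
  forall p : {mpoly K[N]}, mmap (@mpolyC n K) g p \in Q -> p = 0.

Definition snoc N (g : 'I_N -> {mpoly K[n]}) f (i : 'I_N.+1) : {mpoly K[n]} :=
  oapp g f (unlift ord_max i).

Lemma widen_ord_lift N (j : 'I_N) : widen_ord (leqnSn N) j = lift ord_max j.
Proof. by apply: val_inj; rewrite /= /bump leqNgt ltn_ord. Qed.

Lemma muni_inj N : injective (@muni N K).
Proof.
move=> p q; apply: contra_eq => pq; rewrite -subr_eq0 -muniB.
rewrite -subr_eq0 in pq; move: (p - q) pq => {q}p.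
apply: contraNneq => p0; apply/eqP/mpolyP => m.
pose r (m : 'X_{1..N.+1}) := [multinom m (widen_ord (leqnSn N) i) | i < N].
have r_inj m' : r m' = r m -> m' ord_max = m ord_max -> m' = m.
  move=> /mnmP rm lm; apply/mnmP => i; have [j ->|-> //] := unliftP ord_max i.
  by have := rm j; rewrite !mnmE widen_ord_lift.
have := congr1 (fun s : {poly _} => s`_(m ord_max)@_(r m)) p0.
rewrite muniE coef0 !mcoeff0 coef_sum linear_sum /=.
rewrite (eq_bigr (fun m' => p@_m' * (m' == m)%:R)) => [|m' _]; last first.
  rewrite -!mul_mpolyC -/(r m') coefZ coefXn.
  have [<-|mm] := eqVneq m' m; first by rewrite eqxx mulr1 mcoeffCM mcoeffX eqxx.
  rewrite mulr0; have [lm|] := eqVneq; last by rewrite mulr0 mcoeff0.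
  rewrite mulr1 mcoeffCM mcoeffX (_ : _ == _ = false) ?mulr0 //.
  by apply: contra_neqF mm => /eqP /r_inj; apply.
have [ms|/memN_msupp_eq0 -> //] := boolP (m \in msupp p).
rewrite (bigD1_seq m) ?msupp_uniq //= eqxx mulr1 big1 ?addr0 // => m' /negPf ->.
by rewrite mulr0.
Qed.

Lemma mmap_snoc N (g : 'I_N -> {mpoly K[n]}) f (p : {mpoly K[N.+1]}) :
  mmap (@mpolyC n K) (snoc g f) p =
  (map_poly (mmap (@mpolyC n K) g) (muni p)).[f].
Proof.
rewrite muniE rmorph_sum horner_sum /mmap; apply: eq_bigr => m _ /=.
rewrite -[X in X *: _]mul_mpolyC map_polyZ map_polyXn /= hornerZ hornerXn.
rewrite rmorphM /= mmapC mmapX -mulrA; congr (_ * _).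
rewrite /mmap1 big_ord_recr /= {2}/snoc unlift_none; congr (_ * _).
apply: eq_bigr => i _; rewrite mnmE; congr (_ ^+ _).
by rewrite /snoc widen_ord_lift liftK.
Qed.

(** Read a relation between the [g i] and [f] as a polynomial in [f].  Modulo
    the larger prime only its constant term survives, so that term is zero by
    independence; primality of the smaller ideal then allows to cancel [f], and
    the degree drops. *)
Lemma alg_indep_mod_snoc N Q0 Q (g : 'I_N -> {mpoly K[n]}) f :
  {subset Q0 <= Q} -> alg_indep_mod Q g -> f \in Q -> f \notin Q0 ->
  alg_indep_mod Q0 (snoc g f).
Proof.
move=> sQ indg fQ fQ0 p; rewrite mmap_snoc => pQ0; apply: muni_inj.
rewrite raddf0; elim/poly_ind: (muni p) pQ0 => // q c IHq.
rewrite rmorphD rmorphM /= map_polyX map_polyC /= hornerMXaddC => qcQ0.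
have c0 : c = 0.
  by apply: indg; move/sQ: qcQ0; rewrite rpredDl ?idealMr.
move: qcQ0; rewrite c0 raddf0 addr0 prime_idealrM (negPf fQ0) orbF => /IHq ->.
by rewrite mul0r polyC0 addr0.
Qed.

Lemma alg_indep_mod_bound N Q (g : 'I_N -> {mpoly K[n]}) :
  alg_indep_mod Q g -> (N <= n)%N.
Proof.
move=> indg; rewrite leqNgt; apply/negP => /(alg_dependent g)[p p0 gp].
by move/eqP: p0; apply; apply: indg; rewrite gp rpred0.
Qed.

(** Descending a chain, each strict inclusion provides one more independent
    element. *)
Lemma prime_chain_bound N Q (g : 'I_N -> {mpoly K[n]}) k :
  alg_indep_mod Q g -> prime_chain Q k -> (N + k <= n)%N.
Proof.
move=> indg [c [ck cinc]].
have : forall i, (i <= k)%N -> forall N (g : 'I_N -> {mpoly K[n]}),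
    alg_indep_mod (c i) g -> (N + i <= n)%N.
  elim=> [|i IHi] ik M h indh; first by rewrite addn0 (alg_indep_mod_bound indh).
  have [sub nsub] := cinc i ik; rewrite leqNgt; apply/negP => ltn; apply: nsub => f fc.
  apply: contraTT ltn => nfc; rewrite -leqNgt addnS -addSn.
  by apply: (IHi (ltnW ik) _ (snoc h f)); apply: (alg_indep_mod_snoc sub indh).
by move/(_ k (leqnn k) _ g); apply => p; rewrite ck; apply: indg.
Qed.

End Step.

(** * Chains of toric primes *)

Section Kernel.
Variables (R : comNzRingType) (S : idomainType) (f : {rmorphism R -> S}).

Definition kernel : pred R := fun x => f x == 0.

Lemma kernelE x : (x \in kernel) = (f x == 0). Proof. by []. Qed.

Lemma kernel_idealr : idealr_closed kernel.
Proof.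
split=> [||a x y]; rewrite !kernelE ?rmorph0 ?rmorph1 ?oner_eq0 //.
by move=> /eqP fx /eqP fy; rewrite rmorphD rmorphM fx fy mulr0 addr0.
Qed.

Lemma kernel_prime : prime_idealr_closed kernel.
Proof. by move=> x y; rewrite !kernelE rmorphM mulf_eq0. Qed.

HB.instance Definition _ := isIdealr.Build R kernel kernel_idealr.
HB.instance Definition _ := isPrimeIdealrClosed.Build R kernel kernel_prime.

Definition kernel_ideal : prime_idealr R := kernel.

Lemma kernel_idealE x : (x \in kernel_ideal) = (f x == 0). Proof. by []. Qed.

End Kernel.

(** A chain ending at [I] can be prolonged by any strictly larger prime [Q]. *)
Lemma prime_chain_height_le (R : comNzRingType) (I Q : prime_idealr R) k h :
  prime_chain I k -> {subset I <= Q} -> prime_height Q h -> (k <= h)%N.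
Proof.
move=> [c [ck cinc]] IQ [_ Qmax].
rewrite leqNgt; apply/negP => hk; suff QI : {subset Q <= I}.
  move: hk; rewrite ltnNge => /negP; apply; apply: Qmax; exists c; split=> // f.
  by rewrite ck; apply/idP/idP => [/IQ|/QI].
move=> f fQ; apply: contraTT hk => fI; rewrite -leqNgt ltnW // Qmax //.
exists (fun i => if (i <= k)%N then c i else Q); split=> [x|i]; first by rewrite ltnn.
rewrite ltnS => ik; rewrite ik; case: ltnP => [/cinc//|ki].
have {ik ki} -> : i = k by apply/anti_leq/andP.
split=> [x|QI]; first by rewrite ck; apply: IQ.
by move/negP: fI; rewrite -ck; apply; apply: QI.
Qed.

Section RmorphMmap.
Variables (n : nat) (R : nzRingType) (S1 S2 : comNzRingType).
Variables (f : {rmorphism S1 -> S2}) (h1 : {rmorphism R -> S1}) (h2 : R -> S2).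
Variables (g1 : 'I_n -> S1) (g2 : 'I_n -> S2).

Lemma rmorph_mmap (p : {mpoly R[n]}) : (forall c, f (h1 c) = h2 c) ->
  (forall i, f (g1 i) = g2 i) -> f (mmap h1 g1 p) = mmap h2 g2 p.
Proof.
move=> fh fg; rewrite rmorph_sum; apply: eq_bigr => m _ /=.
rewrite rmorphM fh rmorph_prod; congr (_ * _); apply: eq_bigr => i _ /=.
by rewrite rmorphXn /= fg.
Qed.
End RmorphMmap.

(** Distinct monomials have distinct, hence linearly independent, images. *)
Lemma mmap_monomials_inj (K : fieldType) N q (w : 'I_N -> 'X_{1..q})
    (p : {mpoly K[N]}) :
  injective (fun m : 'X_{1..N} => (\sum_i w i *+ m i)%MM) ->
  mmap (@mpolyC q K) (fun i => 'X_[w i]) p = 0 -> p = 0.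
Proof.
move=> winj p0; apply/mpolyP => m; rewrite mcoeff0.
have [mp|/memN_msupp_eq0 //] := boolP (m \in msupp p).
have := congr1 (mcoeff (\sum_i w i *+ m i)%MM) p0.
rewrite mcoeff0 /mmap linear_sum /= (bigD1_seq m) ?msupp_uniq //= => pm.
have E m' : mmap1 (fun i => 'X_[w i]) m' = 'X_[K, (\sum_i w i *+ m' i)%MM].
  rewrite (big_morph (fun m => 'X_[K, m]) (@mpolyXD q K) (mpolyX0 q K)).
  by apply: eq_bigr => i _; rewrite mpolyXn.
rewrite -[LHS]addr0 -[RHS]pm; congr (_ + _).
  by rewrite E mul_mpolyC mcoeffZ mcoeffX eqxx mulr1.
rewrite big1 // => m' /negPf mm'; rewrite E mul_mpolyC mcoeffZ mcoeffX.
by rewrite (inj_eq winj) mm' mulr0.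
Qed.
Section ToricChain.
Variables (K : fieldType) (R : idomainType) (n : nat).
Variables (iota : {rmorphism K -> R}) (v : 'I_n -> R).
Implicit Types (S T : {set 'I_n}) (q : 'X_{1..n}).

Local Notation theta := (mmap iota v).

(** Deformation of the map x_i |-> v_i in which v_i is multiplied by a fresh
    variable for each i outside [S].  Fewer fresh variables means more relations,
    and the full index set gives back the original map. *)
Definition lift_gens S (i : 'I_n) : {mpoly R[n]} :=
  (if i \in S then 1 else 'X_i) * (v i)%:MP.

Definition lift_map S : {rmorphism {mpoly K[n]} -> {mpoly R[n]}} :=
  mmap (@mpolyC n R \o iota) (lift_gens S).

Definition lift_prime S : prime_idealr {mpoly K[n]} := kernel_ideal (lift_map S).

Lemma lift_primeP S p : reflect (lift_map S p = 0) (p \in lift_prime S).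
Proof. exact: (@eqP _ (lift_map S p) 0). Qed.

(** The map for [T] is the map for [S] followed by setting fresh variables to 1. *)
Lemma lift_prime_sub S T : S \subset T -> {subset lift_prime S <= lift_prime T}.
Proof.
move=> ST p /lift_primeP pS; apply/lift_primeP.
pose sigma := comp_mpoly [tuple if i \in T then 1 else 'X_i : {mpoly R[n]} | i < n].
have <- : sigma (lift_map S p) = lift_map T p; last by rewrite pS /sigma comp_mpoly0.
apply: rmorph_mmap => [k|i] /=; first by rewrite comp_mpolyC.
rewrite rmorphM /= comp_mpolyC /lift_gens; congr (_ * _).
case: ifP => [/(subsetP ST) ->|_]; first by rewrite rmorph1.
by rewrite comp_mpolyXU -tnth_nth tnth_mktuple.
Qed.

Lemma lift_primeT p : (p \in lift_prime setT) = (theta p == 0).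
Proof.
have lift_pT : (theta p)%:MP = lift_map setT p.
  by apply: rmorph_mmap => // i; rewrite /lift_gens inE mul1r.
apply/lift_primeP/eqP; first by rewrite -lift_pT => /eqP; rewrite mpolyC_eq0 => /eqP.
by move=> p0; rewrite -lift_pT p0 mpolyC0.
Qed.

Lemma lift_map_monomial S q : (forall i, i \notin S -> q i = 0%N) ->
  lift_map S 'X_[q] = (theta 'X_[q])%:MP.
Proof.
move=> qS; rewrite /= !mmapX rmorph_prod; apply: eq_bigr => i _ /=.
rewrite rmorphXn /= /lift_gens; case: ifPn => [_|/qS ->]; last by rewrite !expr0.
by rewrite mul1r.
Qed.

(** If v_a is a ratio of monomials in the v_i with i in [S], the binomial
    expressing this lies in the kernel once the fresh variable of [a] is gone;
    before that its image is a nonzero multiple of that variable minus 1. *)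
Lemma lift_prime_strict S T (a : 'I_n) q1 q2 : S \subset T -> a \in T -> a \notin S ->
  (forall i, i \notin S -> q1 i = 0%N) -> (forall i, i \notin S -> q2 i = 0%N) ->
  theta ('X_a * 'X_[q1]) = theta 'X_[q2] -> theta 'X_[q2] != 0 ->
  ~ {subset lift_prime T <= lift_prime S}.
Proof.
move=> ST aT aS q1S q2S q12 q2_neq0 sub.
have mapE S' : S \subset S' -> lift_map S' ('X_a * 'X_[q1] - 'X_[q2]) =
    ((if a \in S' then 1 else 'X_a) - 1) * (theta 'X_[q2])%:MP.
  move=> SS'; have qS' q : (forall i, i \notin S -> q i = 0%N) ->
      forall i, i \notin S' -> q i = 0%N.
    by move=> qS i iS'; apply: qS; apply: contra iS'; apply/subsetP.
  rewrite rmorphB rmorphM (lift_map_monomial (qS' _ q1S)).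
  rewrite (lift_map_monomial (qS' _ q2S)).
  rewrite mulrBl mul1r -q12 (rmorphM (mmap iota v)) /= !mmapX !mmap1U /lift_gens.
  by rewrite mpolyCM mulrA.
have : 'X_a * 'X_[q1] - 'X_[q2] \in lift_prime S.
  by apply: sub; apply/lift_primeP; rewrite mapE // aT subrr mul0r.
move/lift_primeP/eqP; rewrite mapE // (negPf aS).
rewrite mulf_eq0 mpolyC_eq0 (negPf q2_neq0) orbF.
move/eqP/(congr1 (mcoeff U_(a)))/eqP; rewrite mcoeff0 mcoeffB mcoeffX mcoeff1.
by rewrite eqxx mnm1_eq0 subr0 oner_eq0.
Qed.

(** The chain runs through the index sets obtained from [S] by adding the
    remaining indices one by one. *)
Lemma toric_chain (I : prime_idealr {mpoly K[n]}) S h :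
  (forall p, (p \in I) = (theta p == 0)) -> (#|S| + h = n)%N ->
  (forall a, a \notin S -> exists q1 q2,
    [/\ forall i, i \notin S -> q1 i = 0%N, forall i, i \notin S -> q2 i = 0%N,
        theta ('X_a * 'X_[q1]) = theta 'X_[q2] & theta 'X_[q2] != 0]) ->
  prime_chain I h.
Proof.
move=> IE nE ratio; pose e := enum (~: S).
have size_e : size e = h.
  by apply/eqP; rewrite -cardE -(eqn_add2l #|S|) cardsC card_ord nE.
pose T k := [set i | i \notin drop k e].
have Tinc k : T k \subset T k.+1.
  apply/subsetP => i; rewrite !inE; apply: contra; rewrite -addn1 addnC -drop_drop.
  exact: mem_drop.
exists (fun k => lift_prime (T k)); split=> [p|k kh].
  rewrite IE (_ : T h = setT) ?lift_primeT //.
  by apply/setP => i; rewrite !inE -size_e drop_size.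
split; first exact: lift_prime_sub.
have ke : (k < size e)%N by rewrite size_e.
have [i0 _] : exists i0, i0 \in e.
  by case: (e) ke => // i0 e' _; exists i0; rewrite mem_head.
have eE := drop_nth i0 ke; set a := nth i0 e k in eE.
have ST i : i \notin T k -> i \notin S.
  by rewrite inE negbK => /mem_drop; rewrite mem_enum inE.
have aTk : a \notin T k by rewrite inE eE mem_head.
have [q1 [q2 [q1S q2S q12 q2_neq0]]] := ratio a (ST a aTk).
apply: (lift_prime_strict (Tinc k) _ aTk _ _ q12 q2_neq0) =>
  [|i /ST/q1S //|i /ST/q2S //].
by rewrite inE; have := drop_uniq k (enum_uniq (~: S)); rewrite -/e eE => /andP[].
Qed.

End ToricChain.

(** * Ranks and maximal chains in a lattice of poset ideals *)

Section IdealLattice.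
Local Open Scope order_scope.
Variables (d d' : Order.disp_t).
Variables (L : finTBDistrLatticeType d) (P : finPOrderType d') (phi : L -> {set P}).
Hypothesis Lphi : ideal_lattice_iso phi.

Definition rk (a : L) : nat := #|phi a|.

Lemma phi_le a b : (phi a \subset phi b) = (a <= b).
Proof. by case: Lphi => ->. Qed.

Lemma phi_inj : injective phi.
Proof. by move=> a b ab; apply/le_anti; rewrite -!phi_le ab subxx. Qed.

Lemma le_rk_eq a b : a <= b -> (rk b <= rk a)%N -> a = b.
Proof. by rewrite -phi_le => ab ba; apply: phi_inj; apply/eqP; rewrite eqEcard ab. Qed.

Lemma rk_max a : (rk a < #|P|.+1)%N.
Proof. exact: max_card. Qed.

Lemma rk_incomparable a b : rk a = rk b -> a != b -> a >< b.
Proof.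
move=> ab; apply: contraNN => /orP[] /le_rk_eq E; last rewrite eq_sym;
by apply/eqP/E; rewrite ab.
Qed.

(** Adding to an ideal a minimal element of its complement gives an ideal. *)
Lemma ex_upper_cover a : (rk a < #|P|)%N ->
  exists p b, p \notin phi a /\ phi b = p |: phi a.
Proof.
move=> aP; have [p0 p0a] : exists p, p \notin phi a.
  apply/existsP; rewrite -negb_forall; apply: contraL aP => /forallP aT.
  by rewrite -leqNgt /rk (eq_card (_ : _ =i predT)) // => p; rewrite aT.
(* Minimality in P is obtained by minimising the number of elements below. *)
have [p pa pmin] := @arg_minnP _ p0 [pred p | p \notin phi a]
                      (fun p => #|[set q : P | q < p]|) p0a.
have [_ idP surj] := Lphi.
have [|b phib] := surj (p |: phi a); last by exists p, b.
move=> q r rq; rewrite !inE => /orP[/eqP qp|/(idP a _ _ rq) ->]; last exact: orbT.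
have [->//|rp /=] := eqVneq r p; apply: contraT => ra.
have := pmin r ra; rewrite leqNgt => /negP[]; apply/proper_card/properP; split.
  by apply/subsetP => s; rewrite !inE => /lt_le_trans; apply; rewrite -qp.
by exists r; rewrite !inE ?ltxx // lt_neqAle rp -qp.
Qed.

(** Removing a maximal element from an ideal gives an ideal. *)
Lemma ex_lower_cover a : (0 < rk a)%N ->
  exists p b, p \notin phi b /\ phi a = p |: phi b.
Proof.
move=> /card_gt0P[p0 p0a].
have [p pa pmin] := @arg_minnP _ p0 [in phi a]
                      (fun p => #|[set q : P | p < q]|) p0a.
have [_ idP surj] := Lphi.
have [|b phib] := surj (phi a :\ p); last first.
  by exists p, b; rewrite phib !inE eqxx setD1K.
move=> q r rq; rewrite !inE => /andP[qp qa]; rewrite (idP a q r rq qa) andbT.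
apply: contraNneq qp => rp; apply: contraT => qp.
have := pmin q qa; rewrite leqNgt => /negP[]; apply/proper_card/properP; split.
  by apply/subsetP => s; rewrite !inE; apply: le_lt_trans; rewrite -rp.
by exists q; rewrite !inE ?ltxx // lt_neqAle eq_sym qp -rp.
Qed.

Lemma ex_rk0 : exists a, rk a = 0%N.
Proof.
have [_ _ surj] := Lphi; have [|a phia] := surj set0; last first.
  by exists a; rewrite /rk phia cards0.
by move=> p q; rewrite inE.
Qed.

Lemma cover_rk a b p : p \notin phi a -> phi b = p |: phi a ->
  a <= b /\ rk b = (rk a).+1.
Proof. by move=> pa bE; rewrite -phi_le /rk bE subsetUr cardsU1 pa. Qed.

Lemma ex_above a : (rk a < #|P|)%N -> exists2 b, a <= b & rk b = (rk a).+1.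
Proof. by move=> /ex_upper_cover[p [b [pa /(cover_rk pa)[]]]]; exists b. Qed.

Lemma ex_below b : (0 < rk b)%N -> exists2 a, a <= b & rk b = (rk a).+1.
Proof. by move=> /ex_lower_cover[p [a [pa /(cover_rk pa)[]]]]; exists a. Qed.

(** A maximal chain listed by rank, as a total function on [nat] so that its
    members can be named without carrying bounds. *)
Definition flag (c : nat -> L) : Prop :=
  (forall i, (i <= #|P|)%N -> rk (c i) = i) /\
  (forall i, (i < #|P|)%N -> c i <= c i.+1).

Lemma flag_le c i j : flag c -> (i <= j)%N -> (j <= #|P|)%N -> c i <= c j.
Proof.
move=> [_ cinc]; elim: j => [|j IHj]; first by rewrite leqn0 => /eqP->.
rewrite leq_eqVlt => /predU1P[-> //|ij] jP.
by apply: le_trans (cinc j jP); apply: IHj => //; apply: ltnW.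
Qed.

Lemma flag_comparable c i j : flag c -> (i <= #|P|)%N -> (j <= #|P|)%N -> c i >=< c j.
Proof.
move=> fc iP jP; rewrite /Order.comparable; case: (leqP i j) => [ij|/ltnW ij].
  by rewrite flag_le.
by rewrite (flag_le fc ij iP) orbT.
Qed.

Lemma flag_through x : exists2 c, flag c & c (rk x) = x.
Proof.
pose up a := odflt a [pick b | (a <= b) && (rk b == (rk a).+1)].
pose down a := odflt a [pick b | (b <= a) && (rk a == (rk b).+1)].
have upP a : (rk a < #|P|)%N -> a <= up a /\ rk (up a) = (rk a).+1.
  move=> /ex_above[b ab rb].
  rewrite /up; case: pickP => [e /andP[? /eqP ?] //|/(_ b)].
  by rewrite ab rb eqxx.
have downP a : (0 < rk a)%N -> down a <= a /\ rk (down a) = (rk a).-1.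
  move=> /ex_below[b ba ra].
  rewrite /down; case: pickP => [e /andP[? /eqP ->] //|/(_ b)].
  by rewrite ba ra eqxx.
have rk_down k : (k <= rk x)%N -> rk (iter k down x) = (rk x - k)%N.
  elim: k => [|k IHk] kx; first by rewrite subn0.
  have rkx := IHk (ltnW kx).
  by rewrite iterS (downP _ _).2 ?rkx ?subn_gt0 // subnS.
have rk_up k : (rk x + k <= #|P|)%N -> rk (iter k up x) = (rk x + k)%N.
  elim: k => [|k IHk]; rewrite ?addn0 // addnS => kx.
  by have rkx := IHk (ltnW kx); rewrite iterS (upP _ _).2 ?rkx.
(* Truncated subtraction: below the rank of x only [down] acts, above it only
   [up]. *)
exists (fun i => iter (i - rk x) up (iter (rk x - i) down x)); last by rewrite subnn.
split=> i iP; case: (leqP (rk x) i) => [xi|ix].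
- by rewrite (eqP xi) rk_up subnKC.
- by rewrite (eqP (ltnW ix)) rk_down ?leq_subr // subKn // ltnW.
- rewrite (eqP xi) (eqP (leqW xi)) subSn // iterS; apply: (upP _ _).1.
  by rewrite rk_up subnKC // ltnW.
- rewrite (eqP ix) (eqP (ltnW ix)) -(subnSK ix) iterS; apply: (downP _ _).1.
  by rewrite rk_down ?leq_subr // subKn.
Qed.

Lemma maximal_chain_through x : exists C : {set L},
  [/\ x \in C, {in C &, forall y z, y >=< z} & #|C| = #|P|.+1].
Proof.
have [c fc cx] := flag_through x; exists [set c i | i : 'I_#|P|.+1]; split.
- by rewrite -cx; apply/imsetP; exists (Ordinal (rk_max x)).
- move=> _ _ /imsetP[i _ ->] /imsetP[j _ ->].
  exact: flag_comparable (leq_ord i) (leq_ord j).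
- rewrite card_imset ?card_ord // => i j cij; apply/val_inj.
  by rewrite /= -(fc.1 i (leq_ord i)) cij fc.1 ?leq_ord.
Qed.

(** * Thin lattices, two-colourings and matchings *)

(** Elements of equal rank are incomparable, so each rank has at most two
    elements, and the two chains are built rank by rank.  If the chosen upper
    covers of [a] and [b] coincide and the next rank has a second element [y],
    a lower cover of [y] tells which of the two chains continues with [y]. *)
Lemma thin_two_flags : thin L -> exists c1 c2,
  [/\ flag c1, flag c2 & forall x, x = c1 (rk x) \/ x = c2 (rk x)].
Proof.
move=> thinL.
have level_two x y z : rk x = rk y -> rk z = rk y -> x != y -> z = x \/ z = y.
  move=> xy zy nxy; have [->|zx] := eqVneq z x; first by left.
  have [->|zy'] := eqVneq z y; first by right.
  case: (thinL [set x; y; z]); last first.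
    by rewrite setUC cardsU1 cards2 !inE negb_or nxy zx zy'.
  move=> u v; rewrite !inE -!orbA => uE vE; apply: rk_incomparable.
  by case/or3P: uE => /eqP->; case/or3P: vE => /eqP->; rewrite ?xy ?zy.
have step a b i : rk a = i -> rk b = i -> (i < #|P|)%N ->
    (forall x, rk x = i -> x = a \/ x = b) ->
  exists x y, [/\ a <= x, b <= y, rk x = i.+1, rk y = i.+1 &
    forall z, rk z = i.+1 -> z = x \/ z = y].
  move=> ra rb iP lev.
  have [|x ax rx] := @ex_above a; first by rewrite ra.
  have [|y bY ry] := @ex_above b; first by rewrite rb.
  rewrite ra in rx; rewrite rb in ry.
  have [xy|xy] := eqVneq x y; last first.
    by exists x, y; split=> // z rz; apply: level_two xy; rewrite ?rz ?rx ?ry.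
  rewrite -{}xy {y ry} in bY *.
  case: (pickP (fun z => (rk z == i.+1) && (x != z))) => [y /andP[/eqP ry xy]|none].
    have two z : rk z = i.+1 -> z = x \/ z = y.
      by move=> rz; apply: level_two xy; rewrite ?rz ?rx ?ry.
    have [|e ey re] := @ex_below y; first by rewrite ry.
    have [ea|eb] := lev e (succn_inj (etrans (esym re) ry)).
      by exists y, x; rewrite -ea; split=> // z /two[]; [right|left].
    by exists x, y; rewrite -eb; split.
  exists x, x; split=> // z rz; left; apply/esym/eqP.
  by have := none z; rewrite rz eqxx /= => /negbFE.
have build k : (k <= #|P|)%N -> exists c1 c2 : nat -> L,
    [/\ forall i, (i <= k)%N -> rk (c1 i) = i /\ rk (c2 i) = i,
        forall i, (i < k)%N -> c1 i <= c1 i.+1 /\ c2 i <= c2 i.+1 &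
        forall x, (rk x <= k)%N -> x = c1 (rk x) \/ x = c2 (rk x)].
  elim: k => [_|k IHk kP].
    have [a ra] := ex_rk0; exists (fun=> a), (fun=> a); split=> [i|//|x].
      by rewrite leqn0 => /eqP->.
    rewrite leqn0 => /eqP rx; left.
    have [//|/(rk_incomparable (etrans rx (esym ra)))] := eqVneq x a.
    case/negP; apply/orP; left; rewrite -phi_le.
    by move/eqP: rx; rewrite /rk cards_eq0 => /eqP->; rewrite sub0set.
  have [c1 [c2 [rkc lec all2]]] := IHk (ltnW kP).
  have [rc1 rc2] := rkc k (leqnn k).
  have [|x [y [ax bY rx ry two]]] := step (c1 k) (c2 k) k rc1 rc2 kP.
    by move=> x rx; have := all2 x; rewrite rx; apply.
  pose ext (c : nat -> L) x i := if (i <= k)%N then c i else x.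
  exists (ext c1 x), (ext c2 y); rewrite /ext; split=> [i ik|i ik|z zk].
  - by case: leqP => [/rkc//|ki]; rewrite rx ry (@anti_leq i k.+1) // ik ki.
  - rewrite ltnS in ik; rewrite ik; case: ltnP => [/lec //|ki].
    by rewrite (@anti_leq i k) // ik ki.
  - case: leqP => [/all2//|kz]; apply: two; apply/anti_leq; rewrite zk kz //.
have [c1 [c2 [rkc lec all2]]] := build _ (leqnn _).
exists c1, c2; split=> [||x]; last by apply: all2; rewrite -ltnS rk_max.
- by split=> i iP; [case: (rkc i iP)|case: (lec i iP)].
- by split=> i iP; [case: (rkc i iP)|case: (lec i iP)].
Qed.

Lemma thin_bipartite : thin L -> bipartite (incom L).
Proof.
move=> /thin_two_flags[c1 [c2 [f1 f2 all2]]].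
exists [set i | lelt i == c1 (rk (lelt i))] => u v; rewrite /incom !inE.
apply: contraNneq; have rP x : (rk x <= #|P|)%N by rewrite -ltnS rk_max.
case: eqP => [-> /esym/eqP ->|ucomp /esym/negbT/eqP vcomp].
  exact: flag_comparable.
have [//|->] := all2 (lelt u); have [//|->] := all2 (lelt v).
exact: flag_comparable.
Qed.

Lemma bipartite_thin : bipartite (incom L) -> thin L.
Proof.
move=> [S Sbip] A antiA /card_gt2P[x [y [z [[xA yA zA] [xy yz zx]]]]].
have key u v : u \in A -> v \in A -> u != v ->
    (enum_rank u \in S) != (enum_rank v \in S).
  by move=> uA vA uv; apply: Sbip; rewrite /incom /lelt !enum_rankK antiA.
have := key _ _ xA yA xy; have := key _ _ yA zA yz; have := key _ _ zA xA zx.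
by do 3!case: (_ \in S).
Qed.

(** The edges are the ranks with two elements.  Their number is read off from
    the enumeration of L by the chain [c1] followed by the second elements of
    these ranks. *)
Lemma thin_matching : thin L -> exists es : seq (L * L),
  [/\ uniq (unzip1 es ++ unzip2 es), forall e, e \in es -> e.1 >< e.2 &
      #|L| = (size es + #|P|.+1)%N].
Proof.
move=> /thin_two_flags[c1 [c2 [f1 f2 all2]]].
pose s := [seq i <- iota 0 #|P|.+1 | c1 i != c2 i].
have sP i : i \in s -> (i <= #|P|)%N by rewrite mem_filter mem_iota => /and3P[].
have c_inj c : flag c -> {in [pred i | i <= #|P|]%N &, injective c}.
  by move=> [rc _] i j iP jP cij; rewrite -(rc i) // cij rc.
have us : uniq s by rewrite filter_uniq ?iota_uniq.
have u2 : uniq [seq c2 i | i <- s].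
  by rewrite map_inj_in_uniq // => i j /sP iP /sP jP; apply: c_inj.
have c12 i j : (i <= #|P|)%N -> (j <= #|P|)%N -> c1 i = c2 j -> i = j.
  by move=> iP jP cij; rewrite -(f1.1 i) // cij f2.1.
have u12 t : uniq t -> {subset t <= iota 0 #|P|.+1} ->
    uniq ([seq c1 i | i <- t] ++ [seq c2 i | i <- s]).
  move=> ut tP; have {}tP i : i \in t -> (i <= #|P|)%N by move/tP; rewrite mem_iota.
  rewrite cat_uniq u2 andbT map_inj_in_uniq ?ut /=; last first.
    by move=> i j /tP iP /tP jP; apply: c_inj.
  apply/hasPn => _ /mapP[i si ->]; apply/mapP => -[j /tP jP /esym cij].
  have ji := c12 _ _ jP (sP i si) cij; move: cij si.
  by rewrite ji mem_filter => ->; rewrite eqxx.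
exists [seq (c1 i, c2 i) | i <- s]; split.
- rewrite /unzip1 /unzip2 -!map_comp; apply: u12 => // i; rewrite mem_filter.
  by case/andP.
- move=> _ /mapP[i si ->] /=; have iP := sP i si.
  apply: rk_incomparable; first by rewrite f1.1 ?f2.1.
  by move: si; rewrite mem_filter => /andP[].
- have /card_uniqP := u12 _ (iota_uniq 0 #|P|.+1) (fun i => id).
  rewrite size_cat !size_map size_iota addnC => <-; apply: eq_card => x; symmetry.
  have rx : rk x \in iota 0 #|P|.+1 by rewrite mem_iota rk_max.
  rewrite mem_cat [RHS]inE.
  have [xE|xc] := eqVneq x (c1 (rk x)); first by rewrite {1}xE map_f.
  have xE : x = c2 (rk x) by case: (all2 x) xc => // /eqP->.
  by rewrite orbC {1}xE map_f // mem_filter rx -xE eq_sym xc.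
Qed.

(** A matching this large meets every maximal chain in exactly one end of each
    edge and covers every element outside the chain.  For an antichain a, b, c,
    a maximal chain through b avoids a and so contains the partner a' of a;
    hence a' lies above both or below both of b and c.  Two of the three
    partners, say a' and b', lie on the same side, and comparing them makes a
    comparable to a' or b to b'. *)
Lemma matching_thin (es : seq (L * L)) :
  uniq (unzip1 es ++ unzip2 es) -> (forall e, e \in es -> e.1 >< e.2) ->
  (#|L| <= size es + #|P|.+1)%N -> thin L.
Proof.
move=> ues ies les.
pose m x y := ((x, y) \in es) || ((y, x) \in es).
pose maxchain (C : {set L}) := {in C &, forall y z, y >=< z} /\ #|C| = #|P|.+1.
have tight C : maxchain C ->
    (forall x, x \notin C -> x \in unzip1 es ++ unzip2 es) /\
    forall e, e \in es -> (e.1 \in C) || (e.2 \in C).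
  move=> [chC cardC]; pose V := unzip1 es ++ unzip2 es.
  have cardC' : (#|~: C| <= size es)%N.
    by rewrite -(leq_add2r #|P|.+1) -cardC addnC cardsC cardC.
  (* Every edge has one end outside C; the second summand counts the edges with
     both ends outside. *)
  have cntV : count [predC C] V =
      (size es + count (fun e => (e.1 \notin C) && (e.2 \notin C)) es)%N.
    rewrite count_cat !count_map -count_predUI; congr (_ + _)%N.
    apply/eqP; rewrite -all_count; apply/allP => e /ies /= inc.
    by apply: contraNT inc; rewrite negb_or !negbK => /andP[]; apply: chC.
  have fV : {subset [seq x <- V | x \notin C] <= enum (~: C)}.
    by move=> x; rewrite mem_filter mem_enum inE => /andP[].
  have ufV : uniq [seq x <- V | x \notin C] by rewrite filter_uniq.
  have szV := uniq_leq_size ufV fV; rewrite -cardE size_filter cntV in szV.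
  split=> [x xC|e ees].
    have [|_ E] := uniq_min_size ufV fV.
      by rewrite -cardE size_filter cntV (leq_trans cardC') ?leq_addr.
    by have := E x; rewrite mem_enum inE xC mem_filter xC => /esym.
  have : count (fun e => (e.1 \notin C) && (e.2 \notin C)) es == 0%N.
    by rewrite -leqn0 -(leq_add2l (size es)) addn0 (leq_trans szV).
  rewrite -leqn0 leqNgt -has_count => /hasPn/(_ e ees).
  by rewrite negb_and !negbK.
have m_ex C x : maxchain C -> x \notin C -> exists y, m x y.
  move=> /tight[+ _] => /[apply]; rewrite mem_cat => /orP[] /mapP[[u v] ees ->];
  by [exists v; rewrite /m ees | exists u; rewrite /m ees orbT].
have m_in C x y : maxchain C -> m x y -> x \notin C -> y \in C.
  by move=> /tight[_ E] /orP[] /E /= /orP[] // -> .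
have m_inc x y : m x y -> ~~ (x >=< y).
  by case/orP => /ies //=; rewrite comparable_sym.
move=> A antiA /card_gt2P[a [b [c [[aA bA cA] [ab bc ca]]]]].
have notin C x y : maxchain C -> x \in C -> x \in A -> y \in A -> x != y -> y \notin C.
  by move=> [chC _] xC xA yA xy; apply: contraNN (antiA _ _ xA yA xy) => yC; apply: chC.
have mc x : exists2 C : {set L}, x \in C & maxchain C.
  by have [C [xC chC cC]] := maximal_chain_through x; exists C.
have up x x' y y' : m x x' -> m y y' -> y <= x' -> x <= y' -> x' >=< y' -> False.
  move=> /m_inc xx' /m_inc yy' yx' xy' /orP[] le'; [move: yy' | move: xx'];
  by rewrite /Order.comparable (le_trans _ le').
have down x x' y y' : m x x' -> m y y' -> x' <= y -> y' <= x -> x' >=< y' -> False.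
  move=> /m_inc xx' /m_inc yy' yx' xy' /orP[] le'; [move: xx' | move: yy'];
  by rewrite /Order.comparable (le_trans le') ?orbT.
have sides (x' y z : L) : y >< z -> y >=< x' -> z >=< x' ->
    (y <= x') && (z <= x') || (x' <= y) && (x' <= z).
  move=> yz /orP[yx|yx] /orP[zx|zx]; rewrite ?yx ?zx ?orbT //.
    by case/negP: yz; rewrite /Order.comparable (le_trans yx zx).
  by case/negP: yz; rewrite /Order.comparable (le_trans zx yx) orbT.
have [Ca aCa mCa] := mc a; have [Cb bCb mCb] := mc b; have [Cc cCc mCc] := mc c.
have partner x y z C D : x \in A -> y \in A -> z \in A -> y != x -> z != x -> y != z ->
    maxchain C -> maxchain D -> y \in C -> z \in D -> exists x',
    [/\ m x x', x' \in C, x' \in D & (y <= x') && (z <= x') || (x' <= y) && (x' <= z)].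
  move=> xA yA zA yx zx yz mC mD yC zD.
  have [x' mxx'] := m_ex C x mC (notin _ _ _ mC yC yA xA yx).
  have x'C := m_in _ _ _ mC mxx' (notin _ _ _ mC yC yA xA yx).
  have x'D := m_in _ _ _ mD mxx' (notin _ _ _ mD zD zA xA zx).
  exists x'; split=> //; apply: sides; [exact: antiA|exact: mC.1|exact: mD.1].
have [ba cb ac] : [/\ b != a, c != b & a != c] by split; rewrite eq_sym.
have [a' [maa' a'b a'c sa]] := partner a b c Cb Cc aA bA cA ba ca bc mCb mCc bCb cCc.
have [b' [mbb' b'a b'c sb]] := partner b a c Ca Cc bA aA cA ab cb ac mCa mCc aCa cCc.
have [c' [mcc' c'a c'b sc]] := partner c a b Ca Cb cA aA bA ac bc ab mCa mCb aCa bCb.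
have a'b' := mCc.1 _ _ a'c b'c.
have a'c' := mCb.1 _ _ a'b c'b.
have b'c' := mCa.1 _ _ b'a c'a.
case/orP: sa => /andP[ba' ca']; case/orP: sb => /andP[ab' cb'];
case/orP: sc => /andP[ac' bc'];
solve [exact: (up a a' b b') | exact: (up a a' c c') | exact: (up b b' c c')
  | exact: (down a a' b b') | exact: (down a a' c c') | exact: (down b b' c c')].
Qed.

End IdealLattice.

(** * The height of the toric ideal of a Hibi ring *)

Section Height.
Variables (K : fieldType) (d d' : Order.disp_t).
Variables (L : finTBDistrLatticeType d) (P : finPOrderType d') (phi : L -> {set P}).
Hypothesis Lphi : ideal_lattice_iso phi.
Local Notation n := #|L|.
Local Notation R := {mpoly K[#|P|.+1]}.
Local Notation u := (fun a : L => hibi_monomial K (phi a)).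

Let hibi_gens := [tuple hibi_monomial K (phi (lelt i)) | i < n].

Definition hibi_prime : prime_idealr {mpoly K[n]} := kernel_ideal (comp_mpoly hibi_gens).

Lemma hibi_primeE : hibi_prime =i hibi_ideal K phi.
Proof. by []. Qed.

Let z_var (p : P) : 'I_#|P|.+1 := widen_ord (leqnSn #|P|) (enum_rank p).

Definition hibi_exponent (a : L) : 'X_{1..#|P|.+1} :=
  (U_(ord_max) + \sum_(p in phi a) U_(z_var p))%MM.

Lemma hibi_monomialE a : u a = 'X_[hibi_exponent a].
Proof.
rewrite mpolyXD (big_morph (fun m => 'X_[K, m]) (@mpolyXD _ K) (mpolyX0 _ K)).
by [].
Qed.

(** The poset element [p] is the ratio of the generators of two consecutive
    members of the chain. *)
Lemma flag_first_occurrence c (p : P) : flag phi c ->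
  exists i, [/\ (i < #|P|)%N, p \notin phi (c i) & phi (c i.+1) = p |: phi (c i)].
Proof.
move=> fc; have [rc cinc] := fc.
have cT : phi (c #|P|) = setT.
  by apply/eqP; rewrite eqEcard subsetT cardsT /= -[X in (X <= _)%N](rc #|P|).
have ex_p : exists i, p \in phi (c i) by exists #|P|; rewrite cT inE.
case: (ex_minnP ex_p) => -[|i] pi imin.
  have := rc 0 isT; rewrite /rk => /eqP; rewrite cards_eq0 => /eqP c0.
  by rewrite c0 inE in pi.
have iP : (i < #|P|)%N by apply: imin; rewrite cT inE.
have pNi : p \notin phi (c i) by apply: contraTN iP => /imin; rewrite ltnn.
exists i; split=> //; apply/esym/eqP; rewrite eqEcard subUset sub1set pi.
rewrite (phi_le Lphi) cinc //= cardsU1 pNi add1n.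
by have := rc _ iP; have := rc _ (ltnW iP); rewrite /rk => -> ->.
Qed.

(** The element added at step [j] separates the members of the chain up to [j]
    from the later ones. *)
Lemma flag_step c j : flag phi c -> (j < #|P|)%N ->
  exists p, forall i, (i <= #|P|)%N -> (p \in phi (c i)) = (j < i)%N.
Proof.
move=> fc jP; have [rc cinc] := fc.
have /properP[_ [p pj pNj]] : phi (c j) \proper phi (c j.+1).
  rewrite properEcard (phi_le Lphi) cinc //=.
  by have := rc _ jP; have := rc _ (ltnW jP); rewrite /rk => -> ->.
exists p => i iP; case: ltnP => [ji|ij].
  by apply: (subsetP _ p pj); rewrite (phi_le Lphi); apply: (flag_le fc).
apply: contraNF pNj; apply: subsetP; rewrite (phi_le Lphi).
by apply: (flag_le fc) => //; apply: ltnW.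
Qed.

(** Along a chain the exponent of t in a monomial is the sum of all m_i and that
    of the poset element added at step j is the tail sum of the m_i with i > j;
    the m_i are differences of consecutive tail sums. *)
Lemma flag_exponents_inj c : flag phi c ->
  injective (fun m : 'X_{1..#|P|.+1} =>
    (\sum_(i < #|P|.+1) hibi_exponent (c i) *+ m i)%MM).
Proof.
move=> fc m m' /mnmP mm'.
have expE k (i : 'I_#|P|.+1) x : (hibi_exponent (c i) *+ k)%MM x =
    (((ord_max == x) + \sum_(p in phi (c i)) (z_var p == x)) * k)%N.
  rewrite mulmnE mnmDE mnm_sumE mnm1E; congr ((_ + _) * _)%N.
  by apply: eq_bigr => p _; rewrite mnm1E.
pose T (m : 'X_{1..#|P|.+1}) j := (\sum_(i < #|P|.+1 | j <= i) m i)%N.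
have T0 (m1 : 'X_{1..#|P|.+1}) :
    ((\sum_(i < #|P|.+1) hibi_exponent (c i) *+ m1 i)%MM) ord_max = T m1 0%N.
  rewrite mnm_sumE; apply: eq_bigr => i _; rewrite expE eqxx big1 ?mul1n // => p _.
  by apply/eqP; rewrite eqb0 -val_eqE /= neq_ltn ltn_ord.
have TS (m1 : 'X_{1..#|P|.+1}) j p :
    (forall i, (i <= #|P|)%N -> (p \in phi (c i)) = (j < i)%N) ->
    ((\sum_(i < #|P|.+1) hibi_exponent (c i) *+ m1 i)%MM) (z_var p) = T m1 j.+1.
  move=> pP; rewrite mnm_sumE /T [RHS]big_mkcond; apply: eq_bigr => i _ /=.
  rewrite expE -pP ?leq_ord // (_ : _ == _ = false) ?add0n; last first.
    by rewrite -val_eqE /= gtn_eqF.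
  rewrite (eq_bigr (fun q => (q == p) : nat)) => [|q _]; last first.
    by rewrite -val_eqE /= val_eqE (inj_eq enum_rank_inj).
  case: ifP => pi; last first.
    by rewrite big1 // => q qi; case: eqP pi qi => // -> ->.
  by rewrite (bigD1 p) //= eqxx big1 ?mul1n // => q /andP[_ /negPf->].
have TE j : (j <= #|P|.+1)%N -> T m j = T m' j.
  case: j => [|j jP]; first by rewrite -!T0 mm'.
  rewrite ltnS leq_eqVlt in jP; case/predU1P: jP => [->|jP].
    by rewrite /T !big_pred0 // => i; rewrite ltnNge leq_ord.
  by have [p pP] := flag_step fc jP; rewrite -!(TS _ _ _ pP) mm'.
have Trec (m1 : 'X_{1..#|P|.+1}) (i : 'I_#|P|.+1) : T m1 i = (m1 i + T m1 i.+1)%N.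
  rewrite /T (bigD1 i) //=; congr (_ + _)%N; apply: eq_bigl => k.
  by rewrite andbC -val_eqE eq_sym ltn_neqAle.
apply/mnmP => i; apply/eqP; rewrite -(eqn_add2r (T m i.+1)) -Trec.
by rewrite (TE i.+1) // -Trec TE // ltnW.
Qed.

Lemma flag_alg_indep c : flag phi c ->
  alg_indep_mod (hibi_ideal K phi)
    (fun i : 'I_#|P|.+1 => 'X_(enum_rank (c i)) : {mpoly K[n]}).
Proof.
move=> fc p; rewrite -hibi_primeE kernel_idealE.
rewrite (@rmorph_mmap _ _ _ _ _ _ (@mpolyC #|P|.+1 K) _
           (fun i => 'X_[hibi_exponent (c i)])).
- by move=> /eqP /mmap_monomials_inj; apply; apply: flag_exponents_inj.
- by move=> k; rewrite /= comp_mpolyC.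
- move=> i; rewrite /= comp_mpolyXU -tnth_nth tnth_mktuple /lelt enum_rankK.
  exact: hibi_monomialE.
Qed.

Lemma hibi_chain_bound k : prime_chain hibi_prime k -> (#|P|.+1 + k <= n)%N.
Proof.
have [a _] := ex_rk0 Lphi; have [c fc _] := flag_through Lphi a.
by move=> ch; apply: (prime_chain_bound (Q := hibi_prime) (flag_alg_indep fc) ch).
Qed.

(** Along the chain, z_p = u_(c (k + 1)) / u_(c k) when p is added at step k + 1,
    and u_(c 0) = t.  So u_a, which is t times the product of the z_p for p in
    the ideal of a, is a ratio of monomials in the chain. *)
Lemma hibi_chain_exists h : (n = #|P|.+1 + h)%N -> prime_chain hibi_prime h.
Proof.
have [a0 _] := ex_rk0 Lphi; have [c fc _] := flag_through Lphi a0.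
move=> nE; pose C := [set enum_rank (c i) | i : 'I_#|P|.+1].
have cardC : #|C| = #|P|.+1.
  rewrite card_imset ?card_ord // => i j /enum_rank_inj cij; apply/val_inj.
  by rewrite /= -(fc.1 i (leq_ord i)) cij fc.1 ?leq_ord.
have CP i : (i <= #|P|)%N -> enum_rank (c i) \in C.
  by move=> iP; apply/imsetP; exists (inord i); rewrite // inordK.
apply: (@toric_chain K _ n (@mpolyC #|P|.+1 K) (tnth hibi_gens) hibi_prime C) =>
  [p|| a _].
- exact: kernel_idealE.
- by rewrite cardC nE.
have /fin_all_exists[k kP] : forall p : P, exists i,
    [/\ (i < #|P|)%N, p \notin phi (c i) & phi (c i.+1) = p |: phi (c i)].
  by move=> p; apply: flag_first_occurrence.
pose x b : 'X_{1..n} := U_(enum_rank b)%MM.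
have xC i : (i <= #|P|)%N -> forall j, j \notin C -> x (c i) j = 0%N.
  by move=> iP j; rewrite mnm1E; case: eqP => // <-; rewrite CP.
pose theta : {rmorphism {mpoly K[n]} -> R} := mmap (@mpolyC #|P|.+1 K) (tnth hibi_gens).
have theta_x b : theta 'X_[x b] = u b.
  by rewrite /theta /= mmapX mmap1U tnth_mktuple /lelt enum_rankK.
have theta_prod f : theta 'X_[\sum_(p in phi (lelt a)) x (c (f p))] =
    \prod_(p in phi (lelt a)) u (c (f p)).
  rewrite (big_morph (fun m => 'X_[K, m]) (@mpolyXD _ K) (mpolyX0 _ K)) rmorph_prod.
  by apply: eq_bigr => p _; apply: theta_x.
exists (\sum_(p in phi (lelt a)) x (c (k p)))%MM.
exists (x (c 0%N) + \sum_(p in phi (lelt a)) x (c (k p).+1))%MM; split.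
- move=> i iC; rewrite mnm_sumE big1 // => p _; have [kp _ _] := kP p.
  by apply: xC iC; apply: ltnW.
- move=> i iC; rewrite mnmDE mnm_sumE xC // big1 // => p _; have [kp _ _] := kP p.
  exact: xC iC.
- rewrite -/theta mpolyXD !(rmorphM theta) theta_x !theta_prod.
  have -> : theta 'X_a = u (lelt a) by rewrite -theta_x /x /lelt enum_valK.
  have c0 : phi (c 0%N) = set0 by apply/eqP; rewrite -cards_eq0; apply/eqP; apply: fc.1.
  rewrite {1 3}/hibi_monomial c0 big_set0 mulr1 -mulrA -big_split; congr (_ * _).
  apply: eq_bigr => p _ /=; have [_ pk ->] := kP p.
  by rewrite /hibi_monomial big_setU1 //= mulrCA.
- rewrite -/theta mpolyXD (rmorphM theta) theta_x theta_prod mulf_eq0 negb_or.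
  have X_neq0 b : u b != 0 by rewrite hibi_monomialE -msupp_eq0 msuppX.
  by rewrite X_neq0; apply/prodf_neq0 => p _; apply: X_neq0.
Qed.


Theorem hibi_height h : (n = #|P|.+1 + h)%N -> ideal_height (hibi_ideal K phi) h.
Proof.
move=> nE; have ch := hibi_chain_exists nE; split; last first.
  by move=> Q k IQ; apply: prime_chain_height_le ch _.
exists hibi_prime; split=> //; split=> // k /hibi_chain_bound.
by rewrite nE leq_add2l.
Qed.

(** Used where a height is only assumed to exist: any prime above the ideal
    inherits its chain. *)
Lemma hibi_height_le h : ideal_height (hibi_ideal K phi) h -> (n <= h + #|P|.+1)%N.
Proof.
move=> [[Q [IQ Qh]] _]; case: (leqP #|P|.+1 n) => [/subnKC nE|/ltnW nP]; last first.
  by rewrite (leq_trans nP) // leq_addl.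
have := prime_chain_height_le (hibi_chain_exists (esym nE)) IQ Qh.
by rewrite leq_subLR addnC.
Qed.

End Height.

(** * Regular sequences of quadratic monomials *)

Section IdealGen.
Variable R : comNzRingType.
Implicit Types (s : seq R).

Lemma ideal_genD s f g : ideal_gen s f -> ideal_gen s g -> ideal_gen s (f + g).
Proof.
move=> [c ->] [e ->]; exists (fun i => c i + e i).
by rewrite -big_split; apply: eq_bigr => i _ /=; rewrite mulrDl.
Qed.

Lemma ideal_gen0 s : ideal_gen s 0.
Proof. by exists (fun=> 0); rewrite big1 // => i _; rewrite mul0r. Qed.

Lemma ideal_gen_mul s a x : x \in s -> ideal_gen s (a * x).
Proof.
move=> xs; have ix : (index x s < size s)%N by rewrite index_mem.
exists (fun i => if i == Ordinal ix then a else 0).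
rewrite (bigD1 (Ordinal ix)) //= eqxx nth_index // big1 ?addr0 // => i /negPf ->.
by rewrite mul0r.
Qed.

End IdealGen.

Section MonomialIdeals.
Variables (K : fieldType) (n : nat).
Implicit Types (ms : seq 'X_{1..n}) (f : {mpoly K[n]}).

Lemma monomial_idealP ms f :
  ideal_gen [seq 'X_[m] | m <- ms] f <->
  forall m, m \in msupp f -> exists2 m0, m0 \in ms & (m0 <= m)%MM.
Proof.
split=> [[c fE] m|fms]; last first.
  rewrite (mpolyE f) big_seq; elim/big_ind: _ => [||m /fms[m0 m0s m0m]].
  - exact: ideal_gen0.
  - by move=> ? ?; apply: ideal_genD.
  rewrite -(submK m0m) mpolyXD scalerAl; apply/ideal_gen_mul.
  exact: (map_f (fun m => 'X_[m])).
rewrite {}fE => /msupp_sum_le /flatten_mapP[i _].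
have ims : (i < size ms)%N by rewrite -(size_map (fun m => 'X_[K, m]) ms).
rewrite (nth_map 0%MM) // => /msuppM_le /allpairsP[[m1 m2] /= [_]].
rewrite msuppX inE => /eqP -> ->; exists (nth 0%MM ms i); last exact: lem_addl.
exact: mem_nth.
Qed.

Definition quad (e : 'I_n * 'I_n) : 'X_{1..n} := (U_(e.1) + U_(e.2))%MM.

Definition disjoint_edges (e f : 'I_n * 'I_n) : bool :=
  [&& e.1 != f.1, e.1 != f.2, e.2 != f.1 & e.2 != f.2].

Lemma uniq_ends (es : seq ('I_n * 'I_n)) : uniq (unzip1 es ++ unzip2 es) =
  all (fun e => e.1 != e.2) es && pairwise disjoint_edges es.
Proof.
elim: es => //= -[a b] es IHes /=.
have /perm_uniq -> :
    perm_eq (unzip1 es ++ b :: unzip2 es) (b :: (unzip1 es ++ unzip2 es)).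
  by rewrite (perm_catCA _ [:: b]).
rewrite /= {}IHes mem_cat inE !mem_cat !negb_or.
have -> : all (disjoint_edges (a, b)) es =
    [&& a \notin unzip1 es, a \notin unzip2 es, b \notin unzip1 es & b \notin unzip2 es].
  elim: es => //= -[c e] es /= ->; rewrite !inE !negb_or /disjoint_edges /=.
  by do 4!case: (_ == _); rewrite /= ?andbF //; do 4!case: (_ \in _).
by case: (a == b); do 4!case: (_ \in _); rewrite /= ?andbF.
Qed.

Lemma quad_gt0 e x : (0 < quad e x)%N = (x == e.1) || (x == e.2).
Proof. by rewrite /quad mnmDE !mnm1E ![x == _]eq_sym; do 2!case: (_ == _). Qed.

Lemma mdeg_quad e : mdeg (quad e) = 2.
Proof. by rewrite mdegD !mdeg1. Qed.

(** If an earlier x_i x_a and a later x_i x_b share x_i, then x_a times the later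
    monomial is x_b times the earlier one, so regularity would put the linear
    form x_a in an ideal generated by quadrics.  Conversely a monomial ideal is
    tested on supports, where a disjoint factor cannot help divisibility. *)
Lemma regular_quads (es : seq ('I_n * 'I_n)) : all (fun e => e.1 != e.2) es ->
  regular_sequence [seq 'X_[quad e] : {mpoly K[n]} | e <- es] <->
  uniq (unzip1 es ++ unzip2 es).
Proof.
rewrite uniq_ends => ->; set s := map _ es.
have sE : s = [seq 'X_[m] | m <- map quad es] by rewrite -map_comp.
have tE k : take k s = [seq 'X_[m] | m <- map quad (take k es)].
  by rewrite sE -!map_take.
have szs : size s = size es by rewrite size_map.
split=> [[reg _]|/= pw].
  case: es => [//|e0 es'] in s sE tE szs reg *.
  set es := e0 :: es' in s sE tE szs reg *.
  apply/(pairwiseP e0) => l k; rewrite !inE => ls ks lk.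
  set e := nth e0 es l; set f := nth e0 es k.
  have nthk : s`_k = 'X_[quad f] by rewrite (nth_map e0).
  have share i a b :
      quad e = (U_(i) + U_(a))%MM -> quad f = (U_(i) + U_(b))%MM -> False.
    move=> eE fE; have : ideal_gen (take k s) 'X_a.
      apply: reg; first by rewrite szs.
      rewrite nthk fE addmC mpolyXD mulrCA [_ * 'X_i]mulrC -mpolyXD -eE.
      apply: ideal_gen_mul; rewrite tE -map_comp; apply/mapP; exists e => //.
      by rewrite /e -(nth_take e0 lk) mem_nth // size_take ks.
    rewrite tE => /monomial_idealP/(_ U_(a)%MM); rewrite msuppX inE eqxx => /(_ isT)[m0].
    case/mapP => e' _ -> /submK /(congr1 mdeg).
    by rewrite mdegD mdeg_quad mdeg1 addn2.
  rewrite /disjoint_edges; apply/and4P; split; apply/eqP => E.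
  - by apply: (share e.1 e.2 f.2); rewrite /quad ?E.
  - by apply: (share e.1 e.2 f.1); rewrite /quad ?E // addmC.
  - by apply: (share e.2 e.1 f.2); rewrite /quad ?E // addmC.
  - by apply: (share e.2 e.1 f.1); rewrite /quad ?E // addmC.
split=> [k f|]; last first.
  rewrite sE => /monomial_idealP/(_ 0%MM); rewrite msupp1 inE eqxx => /(_ isT)[m0].
  case/mapP => e _ -> /submK /(congr1 mdeg).
  by rewrite mdegD mdeg_quad mdeg0 addn2.
rewrite szs => ks; have [e0 _] : exists e0, e0 \in es.
  by case: (es) ks => // e0 es' _; exists e0; rewrite mem_head.
rewrite (nth_map e0) // tE; set e := nth e0 es k => /monomial_idealP fXe.
apply/monomial_idealP => m mf.
have [|m0 /mapP[e' e's ->] le_m] := fXe (m + quad e)%MM.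
  by rewrite (perm_mem (msuppMX _ _)) addmC; apply/mapP; exists m.
exists (quad e'); first exact: map_f.
apply/mnm_lepP => x; have := mnm_lepP le_m x; rewrite mnmDE.
have [->//|] := posnP (quad e' x); rewrite quad_gt0 => xe'.
suff /eqP -> : quad e x == 0%N by rewrite addn0.
rewrite -leqn0 leqNgt quad_gt0.
have [l lk e'E] : exists2 l, (l < k)%N & nth e0 es l = e'.
  exists (index e' es); last by rewrite nth_index // (mem_take e's).
  by rewrite -in_take // (mem_take e's).
have /and4P[? ? ? ?] : disjoint_edges e' e.
  by rewrite -e'E; apply: (pairwiseP e0 pw); rewrite ?inE // (ltn_trans lk).
by case/orP: xe' => /eqP ->; apply/norP.
Qed.

End MonomialIdeals.

(** * Initial monomials of the binomials of a distributive lattice *)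

Section Initial.

Lemma revlex_asym n (s : {perm 'I_n}) u v : revlex s u v -> revlex s v u -> False.
Proof.
rewrite /revlex => /orP[uv|/andP[/eqP uv /existsP[k /andP[vu /forallP kE]]]].
  by rewrite ltnNge (ltnW uv) gtn_eqF.
rewrite uv ltnn eqxx /= => /existsP[l /andP[uv' /forallP lE]].
have [lk|kl|/val_inj kl] := ltngtP l k.
- by have /implyP/(_ lk)/eqP E := lE k; rewrite E ltnn in vu.
- by have /implyP/(_ kl)/eqP E := kE l; rewrite E ltnn in uv'.
- by rewrite kl ltnNge ltnW in uv'.
Qed.

Lemma initial_monomialE (K : fieldType) n (lt : rel 'X_{1..n}) (f : {mpoly K[n]}) m :
  (forall u v, lt u v -> lt v u -> False) -> m \in msupp f ->
  (forall m', m' \in msupp f -> m' != m -> lt m' m) -> initial_monomial lt f = m.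
Proof.
move=> asym mf mmax; rewrite /initial_monomial; set t := filter _ _.
have : m \in t.
  by rewrite mem_filter mf andbT; apply/allP => m' m'f; case: eqVneq => //= /mmax->.
have tE x : x \in t -> x = m.
  rewrite mem_filter => /andP[/allP/(_ m mf) xmax xf].
  have [//|xm] := eqVneq x m; move: xmax; rewrite eq_sym (negPf xm) /= => mx.
  by case: (asym _ _ mx); apply: mmax.
by case: t tE => //= x t' tE _; apply: tE; rewrite mem_head.
Qed.

Variables (K : fieldType) (d : Order.disp_t) (L : finTBDistrLatticeType d).
Variable lt : rel 'X_{1..#|L|}.
Hypothesis lt_revlex : revlex_order lt.
Hypothesis lt_lin : forall i j : 'I_#|L|, (lelt i < lelt j)%O -> lt U_(i)%MM U_(j)%MM.

(** The meet is strictly below i, j and the join, hence the last of the four in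
    the order of the variables; the only monomial containing it is the
    smaller one. *)
Lemma initial_hibi_binomial i j : incom L i j ->
  initial_monomial lt (hibi_binomial L K i j) = quad (i, j).
Proof.
move=> ij; have [s ltE] := lt_revlex.
have ltasym u v : lt u v -> lt v u -> False by rewrite !ltE; apply: revlex_asym.
pose a := enum_rank (lelt i `&` lelt j)%O; pose b := enum_rank (lelt i `|` lelt j)%O.
(* A smaller element of L has a later position in the order of the variables. *)
have pos x y : (lelt x < lelt y)%O -> (s^-1%g y < s^-1%g x)%N.
  move=> /[dup] xy /lt_lin.
  have nxy : x != y by apply: contraTneq xy => ->; rewrite ltxx.
  rewrite ltE /revlex !mdeg1 ltnn eqxx /= => /existsP[k /andP[]]; rewrite !mnm1E.
  have [xk|_] := eqVneq x (s k); last by rewrite ltn0.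
  move=> _ /forallP /(_ (s^-1%g y)).
  rewrite !mnm1E permKV eqxx (negPf nxy) implybF -leqNgt.
  rewrite xk permK leq_eqVlt => /predU1P[/val_inj yk|//].
  by rewrite xk -yk permKV eqxx in nxy.
have zero x (l : 'I_#|L|) : (s^-1%g x < l)%N -> U_(x)%MM (s l) = 0%N.
  by rewrite mnm1E; case: eqP => // ->; rewrite permK ltnn.
have /norP[nij nji] : ~~ ((lelt i <= lelt j) || (lelt j <= lelt i))%O := ij.
have aE : lelt a = (lelt i `&` lelt j)%O by rewrite /a {1}/lelt enum_rankK.
have bE : lelt b = (lelt i `|` lelt j)%O by rewrite /b {1}/lelt enum_rankK.
have lta x : x \in [:: i; j; b] -> (lelt a < lelt x)%O.
  have ai : (lelt a < lelt i)%O.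
    by rewrite aE lt_neqAle leIl andbT; apply: contraNneq nij => <-; exact: leIr.
  rewrite !inE => /or3P[] /eqP-> //; last first.
    by rewrite (lt_le_trans ai) // bE leUl.
  by rewrite aE lt_neqAle leIr andbT; apply: contraNneq nji => <-; exact: leIl.
have ltq : lt (U_(a) + U_(b))%MM (quad (i, j)).
  rewrite ltE /revlex mdeg_quad mdegD !mdeg1 /=; apply/existsP; exists (s^-1%g a).
  have zle x (l : 'I_#|L|) :
      x \in [:: i; j; b] -> (s^-1%g a <= l)%N -> U_(x)%MM (s l) = 0%N.
    by move=> xs al; apply: zero; apply: leq_trans al; apply/pos/lta.
  rewrite !mnmDE /= ![in X in (X < _)%N]zle ?inE ?eqxx ?orbT // mnm1E permKV eqxx /=.
  apply/forallP => l; apply/implyP => al.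
  by rewrite !mnmDE (zero a) // !zle ?inE ?eqxx ?orbT // ltnW.
have fE m : (hibi_binomial L K i j)@_m =
    (quad (i, j) == m)%:R - ((U_(a) + U_(b))%MM == m)%:R.
  by rewrite mcoeffB -!mpolyXD !mcoeffX.
have neq : (U_(a) + U_(b))%MM != quad (i, j).
  by apply/eqP => E; apply: (ltasym _ _ ltq); rewrite -{1}E {2}E.
apply: initial_monomialE => // [|m]; rewrite mcoeff_msupp fE.
  by rewrite eqxx (negPf neq) subr0 oner_eq0.
move=> + mq; rewrite [quad _ == m]eq_sym (negPf mq) sub0r.
by have [<-//|_] := eqVneq (U_(a) + U_(b))%MM m; rewrite oppr0 eqxx.
Qed.
End Initial.

(** * Matchings in the incomparability graph and the equivalence *)

Section Konig.
Variables (K : fieldType) (d : Order.disp_t) (L : finTBDistrLatticeType d).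
Variable lt : rel 'X_{1..#|L|}.
Hypothesis lt_revlex : revlex_order lt.
Hypothesis lt_lin : forall i j : 'I_#|L|, (lelt i < lelt j)%O -> lt U_(i)%MM U_(j)%MM.
Implicit Types (es : seq ('I_#|L| * 'I_#|L|)).

Local Notation binomials es := [seq hibi_binomial L K e.1 e.2 | e <- es].

Lemma incom_neq i j : incom L i j -> i != j.
Proof. by apply: contraTneq => ->; rewrite /incom comparablexx. Qed.

Lemma binomials_regular es : (forall e, e \in es -> incom L e.1 e.2) ->
  regular_sequence
    [seq ('X_[initial_monomial lt g] : {mpoly K[#|L|]}) | g <- binomials es] <->
  uniq (unzip1 es ++ unzip2 es).
Proof.
move=> ies; rewrite -(regular_quads K); last by apply/allP => e /ies/incom_neq.
rewrite -map_comp (@eq_in_map _ _ _ (fun e => 'X_[quad e]) es).1 // => e /ies ie /=.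
by rewrite (initial_hibi_binomial K lt_revlex lt_lin ie) -surjective_pairing.
Qed.

Lemma binomials_uniq es : (forall e, e \in es -> incom L e.1 e.2) ->
  uniq (unzip1 es ++ unzip2 es) -> uniq (binomials es).
Proof.
move=> ies; rewrite uniq_ends uniq_pairwise pairwise_map => /andP[_].
apply: (@sub_in_pairwise _ [in es]); last exact/allP.
move=> e f /ies ie /ies if_ /and4P[e1f1 e1f2 _ _] /=.
apply/eqP => /(congr1 (initial_monomial lt)).
rewrite !(initial_hibi_binomial K lt_revlex lt_lin) // => /mnmP/(_ e.1) E.
have := quad_gt0 (f.1, f.2) e.1; rewrite -E quad_gt0 eqxx /=.
by rewrite (negPf e1f1) (negPf e1f2).
Qed.

Lemma binomials_of (fs : seq {mpoly K[#|L|]}) :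
  (forall g, g \in fs -> exists i j, incom L i j /\ g = hibi_binomial L K i j) ->
  exists2 es, forall e, e \in es -> incom L e.1 e.2 & fs = binomials es.
Proof.
elim: fs => [|g fs IHfs] gens; first by exists [::].
have [i [j [ij gE]]] := gens g (mem_head _ _).
have [|es ies fsE] := IHfs; first by move=> f ffs; apply: gens; rewrite inE ffs orbT.
exists ((i, j) :: es); last by rewrite fsE gE.
by move=> e; rewrite inE => /predU1P[->|/ies].
Qed.

End Konig.

Theorem theorem4p5 (K : fieldType) (d d' : Order.disp_t)
    (L : finTBDistrLatticeType d) (P : finPOrderType d') (phi : L -> {set P})
    (ltrev : rel 'X_{1..#|L|})
    (Lphi : ideal_lattice_iso phi)
    (ltrev_revlex : revlex_order ltrev)
    (ltrev_lin : forall i j : 'I_#|L|,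
       (lelt i < lelt j)%O -> ltrev U_(i)%MM U_(j)%MM) :
  [<-> konig_type (hibi_ideal K phi)
         (fun g => exists i j, incom L i j /\ g = hibi_binomial L K i j) ltrev;
       thin L;
       bipartite (incom L)].
Proof.
tfae.
- case=> h [fs [hI szh _ /binomials_of[es ies fsE]]].
  rewrite {fs}fsE size_map in szh *.
  move/(binomials_regular K ltrev_revlex ltrev_lin ies) => ues.
  apply: (matching_thin Lphi (es := [seq (lelt e.1, lelt e.2) | e <- es])).
  + rewrite /unzip1 /unzip2 -!map_comp.
    rewrite (map_comp (@lelt _ L) fst) (map_comp (@lelt _ L) snd).
    by rewrite -map_cat map_inj_uniq //; apply: enum_val_inj.
  + by move=> _ /mapP[e /ies ie ->].
  + by rewrite size_map szh; apply: hibi_height_le Lphi _ hI.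
- exact: thin_bipartite Lphi.
- move=> /bipartite_thin /(thin_matching Lphi)[es0 [ues ies nE]].
  pose es := [seq (enum_rank e.1, enum_rank e.2) | e <- es0].
  have incom_es e : e \in es -> incom L e.1 e.2.
    by move=> /mapP[f /ies fi ->]; rewrite /incom /lelt !enum_rankK.
  have uniq_es : uniq (unzip1 es ++ unzip2 es).
    rewrite /unzip1 /unzip2 -!map_comp.
    rewrite (map_comp enum_rank fst) (map_comp enum_rank snd).
    by rewrite -map_cat map_inj_uniq //; apply: enum_rank_inj.
  exists (size es), [seq hibi_binomial L K e.1 e.2 | e <- es]; split.
  + by apply: hibi_height Lphi _ _; rewrite size_map addnC -nE.
  + exact: size_map.
  + exact: (binomials_uniq K ltrev_revlex ltrev_lin).
  + by move=> _ /mapP[e ee ->]; exists e.1, e.2; split=> //; apply: incom_es.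
  + exact/(binomials_regular K ltrev_revlex ltrev_lin).
Qed.
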